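(* Let $A\in BL(X)$ and $Ax-zx=y$, where $x,y\in X$ and $z\notin\sigma(A)$. Further let $\delta x$ be the perturbation of the solution $x$ corresponding to the perturbation $\Delta A$ of $A$, i.e. $(A-zI+\Delta A)(x+\delta x)=y$. Then (1) $\displaystyle \frac{\|\delta x\|}{\|x\|}\le \frac{\|\Delta A\|}{\kappa_1(z,A+\Delta A)}$; (2) $\displaystyle \frac{\|\delta x\|}{\|x+\delta x\|}\le \frac{\|\Delta A\|}{\kappa_1(z,A)}$, where $\kappa_1(z,A):=\sup\{\epsilon>0: z\notin\Lambda_\epsilon(A)\}$, and $\kappa_1(z,A+\Delta A)$ is defined in the same way with $A+\Delta A$ in place of $A$.
   Context: $X$ is a complex Banach space and $BL(X)$ is the Banach algebra of all bounded linear operators on $X$, with identity $I$. The spectrum of $A\in BL(X)$ is $\sigma(A)=\{z\in\mathbb{C}: A-zI \text{ is not invertible}\}$. For $\epsilon>0$ the $\epsilon$-pseudospectrum of $A$ is $$\Lambda_\epsilon(A)=\sigma(A)\cup\{z\in\mathbb{C}: \|(A-zI)^{-1}\|\ge \epsilon^{-1}\}.$$ *)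

(* Defs.v *)
From HB Require Import structures.
From mathcomp Require Import all_boot all_order all_algebra.
From mathcomp Require Import all_classical all_reals all_analysis.
From mathcomp Require Import complex.

Set Implicit Arguments.
Unset Strict Implicit.
Unset Printing Implicit Defensive.

Import Order.TTheory GRing.Theory Num.Theory.
Import numFieldNormedType.Exports.

Local Open Scope classical_set_scope.
Local Open Scope ring_scope.
Local Open Scope complex_scope.

Section Pseudospectrum.
Context {R : realType} {X : completeNormedModType R[i]}.
Implicit Types (A T S : X -> X) (z : R[i]).

(* On a normed module over R[i] the library norm takes values in R[i] (where
   they are nonnegative, hence real): [rnorm] is the same norm, read in R. *)
Definition rnorm (x : X) : R := complex.Re `|x|.

(* Operators are plain functions, so that [+], [-] and [*:] below are the
   pointwise operations on [X -> X], and the identity operator is [idfun]. *)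
Definition BL : set (X -> X) :=
  [set A | linear A /\ exists M : R, forall x, rnorm (A x) <= M * rnorm x].

Definition opnorm A : R := sup [set rnorm (A x) | x in [set x | rnorm x <= 1]].

Definition is_inverse T S : Prop :=
  [/\ BL S, T \o S = idfun & S \o T = idfun].

Definition invertible T : Prop := exists S, is_inverse T S.

(* The inverse of [T] in [BL] when [T] is invertible, and 0 otherwise. *)
Definition blinv T : X -> X := xget 0 [set S | is_inverse T S].

Definition spectrum A : set R[i] := [set z | ~ invertible (A - z *: idfun)].

(* The default value of [blinv] plays no role here: it is only taken at points of
   the spectrum, which belong to the union anyway. *)
Definition pseudospectrum (eps : R) A : set R[i] :=
  spectrum A `|` [set z | eps^-1 <= opnorm (blinv (A - z *: idfun))].

(* The supremum is taken in [0, +oo], hence the adjoined 0: it is 0 when [z] is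
   in the spectrum of [A] (no [eps] qualifies), and +oo when X is trivial. *)
Definition kappa1 z A : \bar R :=
  ereal_sup ([set 0%E] `|`
    [set eps%:E | eps in [set eps : R | 0 < eps /\ ~ pseudospectrum eps A z]]).

End Pseudospectrum.

(* Main.v *)
(* Subtracting the two equations gives (A - zI) dx = - dA (x + dx) and
   (A + dA - zI) dx = - dA x.  If T - zI is invertible and (T - zI) v = - D w,
   then |v| <= |(T - zI)^-1| |D| |w|, and |(T - zI)^-1| <= kappa1(z, T)^-1.
   If z is in the spectrum of A + dA, then kappa1(z, A + dA) = 0 and |dA| > 0
   (otherwise z would be in the spectrum of A), so that the bound is +oo. *)
Require Import Defs.
From mathcomp Require Import all_boot all_order all_algebra.
From mathcomp Require Import all_classical all_reals all_analysis.
From mathcomp Require Import complex.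

Import Order.TTheory GRing.Theory Num.Theory.
Import numFieldNormedType.Exports.

Local Open Scope ring_scope.
Local Open Scope complex_scope.

Section PseudospectralBounds.
Set Implicit Arguments.
Unset Strict Implicit.
Variables (R : realType) (X : completeNormedModType R[i]).
Implicit Types (A D T : X -> X) (z : R[i]) (v w x : X).

Lemma rnormE x : `|x| = (rnorm x)%:C.
Proof. by rewrite /rnorm RRe_real ?normr_real. Qed.

Lemma rnorm_ge0 x : 0 <= rnorm x.
Proof. by rewrite -ler0c -rnormE. Qed.

Lemma rnorm_eq0 x : (rnorm x == 0) = (x == 0).
Proof. by rewrite -[x == 0]normr_eq0 rnormE fmorph_eq0. Qed.

Lemma rnorm0 : rnorm (0 : X) = 0.
Proof. by apply/eqP; rewrite rnorm_eq0. Qed.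

Lemma rnormN x : rnorm (- x) = rnorm x.
Proof. by rewrite /rnorm normrN. Qed.

Lemma rnormZ (r : R) x : 0 <= r -> rnorm (r%:C *: x) = r * rnorm x.
Proof.
move=> r0; apply/complexI; rewrite -rnormE normrZ ger0_norm ?ler0c//.
by rewrite rnormE -rmorphM.
Qed.

Lemma BL_lin D : BL D -> linear D.
Proof. by case. Qed.

Lemma BL0 D : BL D -> D 0 = 0.
Proof.
by move=> /BL_lin/(_ (-1) 0 0); rewrite scaler0 addr0 scaleN1r addNr.
Qed.

Lemma BLD D : BL D -> {morph D : v w / v + w}.
Proof. by move=> /BL_lin DL v w; rewrite -[v]scale1r DL !scale1r. Qed.

Lemma BLZ D (a : R[i]) x : BL D -> D (a *: x) = a *: D x.
Proof. by move=> DB; rewrite -[a *: x]addr0 (BL_lin DB) (BL0 DB) addr0. Qed.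

(** [sup] takes a default value on unbounded sets; this bound makes [opnorm] a genuine supremum. *)
Lemma has_ubound_opnorm D : BL D ->
  has_ubound [set rnorm (D x) | x in [set x | rnorm x <= 1]]%classic.
Proof.
(* [M] may be negative when the space is trivial, hence the absolute value. *)
move=> [_ [M DM]]; exists `|M| => _ [x /= x1 <-].
rewrite (le_trans (DM x))// (le_trans (ler_wpM2r (rnorm_ge0 x) (ler_norm M)))//.
by rewrite ler_piMr.
Qed.

Lemma opnorm_ge0 D : BL D -> 0 <= opnorm D.
Proof.
move=> DB; apply: (ub_le_sup (has_ubound_opnorm DB)).
by exists 0; rewrite /= ?BL0// rnorm0.
Qed.

(** For nonzero [w], rescale to the unit vector [w / rnorm w], whose image is bounded by the
    supremum. *)
Lemma opnormP D w : BL D -> rnorm (D w) <= opnorm D * rnorm w.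
Proof.
move=> DB; have [->|w0] := eqVneq w 0; first by rewrite BL0// rnorm0 mulr0.
have nw : 0 < rnorm w by rewrite lt_def rnorm_eq0 w0 rnorm_ge0.
have nV : 0 <= (rnorm w)^-1 by rewrite invr_ge0 rnorm_ge0.
rewrite -ler_pdivrMr// mulrC -rnormZ// -BLZ//.
apply: (ub_le_sup (has_ubound_opnorm DB)).
by exists ((rnorm w)^-1%:C *: w) => //=; rewrite rnormZ// mulVf// gt_eqF.
Qed.

Lemma opnorm_eq0 D x : BL D -> opnorm D = 0 -> D x = 0.
Proof.
move=> DB D0; apply/eqP; rewrite -rnorm_eq0 eq_le rnorm_ge0 andbT.
by have := opnormP x DB; rewrite D0 mul0r.
Qed.

Lemma kappa1_ge0 z A : (0 <= kappa1 z A)%E.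
Proof. by apply: ereal_sup_ubound; left. Qed.

Lemma kappa1_spectrum z A : spectrum A z -> kappa1 z A = 0%E.
Proof.
move=> Az; apply/eqP; rewrite eq_le kappa1_ge0 andbT.
by apply: ge_ereal_sup => _ [->//|[e [_ []]]]; left.
Qed.

Lemma blinvP T : invertible T -> is_inverse T (blinv T).
Proof. exact: xgetPex. Qed.

Lemma BL_blinv T : invertible T -> BL (blinv T).
Proof. by move=> /blinvP[]. Qed.

Lemma blinvK T x : invertible T -> blinv T (T x) = x.
Proof. by move=> /blinvP[_ _ /(congr1 (@^~ x))]. Qed.

(** Off the [e]-pseudospectrum the resolvent norm is below [e^-1], so its inverse bounds every
    admissible [e], hence also [kappa1 z A]. Inversion in the extended reals covers the values 0 and
    +oo. *)
Lemma opnorm_blinv_le_kappa1V z A : ~ spectrum A z ->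
  ((opnorm (blinv (A - z *: idfun)))%:E <= (kappa1 z A)^-1)%E.
Proof.
move=> /contrapT Az; set T := A - _ in Az *.
have n0 := opnorm_ge0 (BL_blinv Az).
rewrite inve_pge ?inE ?lee_fin ?kappa1_ge0//.
apply: ge_ereal_sup => _ [->|[e [e0 ez] <-]]; first by rewrite inve_ge0 lee_fin.
rewrite inve_pge ?inE ?lee_fin ?(ltW e0)// inver gt_eqF// lee_fin.
by apply/ltW; rewrite ltNge; apply/negP => ?; apply: ez; right.
Qed.

(** Serves both bounds: (2) with [A] and [w := x + dx], (1) with [A + dA] and [w := x]. *)
Lemma quotient_le_kappa1 z A D v w : BL D -> ~ spectrum A z ->
  A v - z *: v = - D w ->
  ((rnorm v)%:E / (rnorm w)%:E <= (opnorm D)%:E / kappa1 z A)%E.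
Proof.
move=> DB Az vw; have /contrapT Tinv := Az.
set S := blinv (A - z *: idfun) in (Tinv) *.
have SB : BL S := BL_blinv Tinv.
have [S0 D0] := (opnorm_ge0 SB, opnorm_ge0 DB).
have vE : v = S (- D w) by rewrite -vw /S blinvK.
have vle : rnorm v <= opnorm D * opnorm S * rnorm w.
  rewrite {1}vE (le_trans (opnormP _ SB))// rnormN (mulrC (opnorm D)) -mulrA.
  by rewrite ler_wpM2l// opnormP.
apply: (@le_trans _ _ ((opnorm D * opnorm S)%:E)%E); last first.
  by rewrite EFinM lee_wpmul2l ?lee_fin// opnorm_blinv_le_kappa1V.
rewrite inver; case: eqP vle => [->|/eqP w0].
  (* Here [(rnorm w)^-1] is +oo, but [vle] forces [rnorm v] to be 0, and 0 times +oo is 0. *)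
  rewrite mulr0 => v0; have -> : rnorm v = 0 by apply/le_anti; rewrite v0 rnorm_ge0.
  by rewrite mul0e lee_fin mulr_ge0.
by rewrite -EFinM lee_fin ler_pdivrMr// lt_def w0 rnorm_ge0.
Qed.

End PseudospectralBounds.

(* Quotients are taken in \bar R, where 0^-1 = +oo and 0 * +oo = 0; they are the
   usual ones when the denominator is a nonzero real. *)
Theorem theorem3p3 (R : realType) (X : completeNormedModType R[i])
    (A dA : X -> X) (z : R[i]) (x dx y : X) :
  BL A -> BL dA ->
  ~ spectrum A z ->
  A x - z *: x = y ->
  (A - z *: idfun + dA) (x + dx) = y ->
  ((rnorm dx)%:E / (rnorm x)%:E <= (opnorm dA)%:E / kappa1 z (A + dA)%R)%E /\
  ((rnorm dx)%:E / (rnorm (x + dx)%R)%:E <= (opnorm dA)%:E / kappa1 z A)%E.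
Proof.
move=> AB dAB Az xy pxy.
have sum_eq : A x + A dx - z *: (x + dx) + dA (x + dx) = A x - z *: x.
  by rewrite xy -pxy -(BLD AB).
have eA : A dx - z *: dx = - dA (x + dx).
  (* Adding [A x - z *: x] to both sides reduces the goal to [sum_eq]. *)
  apply/(addrI (A x - z *: x)); apply/eqP; rewrite eq_sym subr_eq -{1}sum_eq.
  by rewrite scalerDr opprD addrACA.
have eAdA : (A + dA) dx - z *: dx = - dA x.
  (* Adding [dA dx] to both sides of [eA] leaves only [- dA x] on the right, by additivity of
     [dA]. *)
  rewrite !fctE addrAC eA (BLD dAB); apply/eqP.
  by rewrite opprD addrNK.
split; last exact: quotient_le_kappa1 eA.
have [zAdA|] := pselect (spectrum (A + dA) z); last first.
  by move=> AdAz; apply: quotient_le_kappa1 eAdA.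
have [dA0|dA_neq0] := eqVneq (opnorm dA) 0.
  have dAE : dA = 0 by apply/funext => v; exact: opnorm_eq0.
  by move: zAdA; rewrite dAE addr0.
rewrite kappa1_spectrum// inve0 gt0_muley ?leey//.
by rewrite lte_fin lt_def dA_neq0 opnorm_ge0.
Qed.
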